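(* Let $\tilde G=\mathbb{R}$ with the Euclidean norm, $G=\mathbb{S}^1=\mathbb{R}/\mathbb{Z}$ with the quotient norm, and let $\phi:\mathbb{R}\to\mathbb{R}/\mathbb{Z}$ be the quotient projection. Let $K\subset\mathbb{R}^d$ be a convex, compact set with nonempty interior and let $\pi:\mathscr{F}_0^{\mathbb{R}}(K)\to\mathscr{F}_0^{\mathbb{S}^1}(K)$ be the map induced by $\phi$. Then the restriction of $\pi$ is surjective between $\{\tilde T\in\mathscr{F}_0^{\mathbb{R}}(K):\mathbb{M}(\tilde T)<\infty\}$ and $\{T\in\mathscr{F}_0^{\mathbb{S}^1}(K):\mathbb{M}(T)<\infty\}$.
   Context: Quotient norm on $\mathbb{R}/\mathbb{Z}$: $\|\phi(x)\|:=\min\{\mathrm{frac}(x),1-\mathrm{frac}(x)\}$ with $\mathrm{frac}(x)=x-\lfloor x\rfloor$. For a complete normed Abelian group $G$: $\mathscr{P}_k^G(K)$ is the group of polyhedral chains, i.e. finite formal sums $P=\sum_{\ell=1}^N g_\ell\llbracket\sigma_\ell\rrbracket$, with $g_\ell\in G$ and $\sigma_\ell\subset K$ non-overlapping oriented $k$-simplexes, identified when they have a common refinement (reversing orientation changes $g_\ell$ to $-g_\ell$). Mass: $\mathbb{M}(P)=\sum_\ell\|g_\ell\|\mathcal{H}^k(\sigma_\ell)$. Boundary: $\partial P=\sum_\ell g_\ell\,\partial\llbracket\sigma_\ell\rrbracket$. Flat norm: $\mathbb{F}(P)=\inf\{\mathbb{M}(Q)+\mathbb{M}(P-\partial Q):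 Q\in\mathscr{P}_{k+1}^G(K)\}$. $\mathscr{F}_k^G(K)$ (flat chains) is the $\mathbb{F}$-completion of $\mathscr{P}_k^G(K)$; mass extends by relaxation, $\mathbb{M}(T)=\inf\{\liminf_n\mathbb{M}(P_n): P_n\in\mathscr{P}_k^G(K),\ \mathbb{F}(P_n-T)\to0\}$. Induced map: on polyhedral chains $\pi(\sum_i\tilde g_i\llbracket\sigma_i\rrbracket):=\sum_i\phi(\tilde g_i)\llbracket\sigma_i\rrbracket$; it is Lipschitz for the flat norms and extends by continuity to $\pi:\mathscr{F}_k^{\mathbb{R}}(K)\to\mathscr{F}_k^{\mathbb{S}^1}(K)$. *)

(* Defs.v *)
From HB Require Import structures.
From mathcomp Require Import all_boot all_order all_algebra.
From mathcomp Require Import all_classical all_reals all_analysis.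
From mathcomp Require Import ring lra zify.
Import Order.TTheory GRing.Theory Num.Theory.
Import numFieldNormedType.Exports.

Set Implicit Arguments.
Unset Strict Implicit.
Unset Printing Implicit Defensive.

Local Open Scope classical_set_scope.
Local Open Scope ring_scope.
Local Open Scope quotient_scope.

(* MathComp's [normedZmodType] forces [`|x *+ n| = `|x| *+ n], which fails in
   R/Z; hence a separate structure. *)
Record normedGroup (R : realType) := NormedGroup {
  ng_sort :> zmodType;
  gnorm : ng_sort -> R;
  gnorm_eq0 : forall g, (gnorm g == 0) = (g == 0);
  gnormN : forall g, gnorm (- g) = gnorm g;
  ler_gnormD : forall g h, gnorm (g + h) <= gnorm g + gnorm h;
  gnorm_complete : forall u : nat -> ng_sort,
    (forall e, 0 < e -> exists N, forall m n,
       (N <= m)%N -> (N <= n)%N -> gnorm (u m - u n) < e) ->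
    exists l, gnorm (u n - l) @[n --> \oo] --> (0 : R) }.

Arguments gnorm {R n} _.

Section NormedGroupTheory.
Context {R : realType} {G : normedGroup R}.
Implicit Types g h : G.

Lemma gnorm0 : gnorm (0 : G) = 0.
Proof. by apply/eqP; rewrite gnorm_eq0. Qed.

Lemma gnorm_ge0 g : 0 <= gnorm g.
Proof.
have := ler_gnormD g (- g); rewrite subrr gnorm0 gnormN => ?; lra.
Qed.

End NormedGroupTheory.

Section RealGroup.
Variable R : realType.

Lemma real_gnorm_complete (u : nat -> R) :
  (forall e, 0 < e -> exists N, forall m n,
     (N <= m)%N -> (N <= n)%N -> `|u m - u n| < e) ->
  exists l, `|u n - l| @[n --> \oo] --> (0 : R).
Proof.
move=> cu; have /cvg_ex[l ul] : cvgn u.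
  apply/cauchy_cvgP/cauchy_exP => e e0.
  have [N uN] := cu e e0.
  by exists (u N), N => // n Nn; apply: uN.
by exists l; apply/norm_cvg0P/subr_cvg0.
Qed.

Definition real_group : normedGroup R :=
  NormedGroup (@normr_eq0 _ R) (@normrN _ R) (@ler_normD _ R)
    real_gnorm_complete.

End RealGroup.

Section Circle.
Variable R : realType.

Definition frac (x : R) : R := x - (Num.floor x)%:~R.

Definition circle : zmodType :=
  Quotient.quot (GRing.ZmodClosed.clone R (@Num.int_num_subdef R) _).

Definition circle_proj (x : R) : circle := \pi x.

Definition circle_norm (t : circle) : R :=
  Num.min (frac (repr t)) (1 - frac (repr t)).

Lemma circle_proj_is_zmod_morphism : zmod_morphism circle_proj.
Proof. by move=> x y; rewrite /circle_proj raddfB. Qed.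

HB.instance Definition _ :=
  GRing.isZmodMorphism.Build R circle circle_proj circle_proj_is_zmod_morphism.

Lemma circle_proj_surj t : exists x, circle_proj x = t.
Proof. by exists (repr t); rewrite /circle_proj reprK. Qed.

Lemma circle_proj_eq x y :
  (circle_proj x == circle_proj y) = (x - y \is a Num.int).
Proof. by rewrite /circle_proj -Quotient.idealrBE. Qed.

Lemma frac_itv x : 0 <= frac x < 1.
Proof.
by have := floor_itv x; rewrite /frac intrD => /andP[? ?]; apply/andP; split; lra.
Qed.

Lemma circle_proj_frac x : circle_proj (frac x) = circle_proj x.
Proof.
by apply/eqP; rewrite circle_proj_eq /frac addrAC subrr add0r rpredN intr_int.
Qed.

Lemma circle_normE x :
  circle_norm (circle_proj x) = Num.min (frac x) (1 - frac x).
Proof.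
suff fE : frac (repr (circle_proj x)) = frac x by rewrite /circle_norm fE.
have: circle_proj (repr (circle_proj x)) == circle_proj x.
  by rewrite {1}/circle_proj reprK.
rewrite circle_proj_eq; set y := repr _ => iyx.
have -> : y = x + (y - x) by lra.
rewrite /frac floorDrz // intrD.
by move: iyx; rewrite intrEfloor => /eqP ->; lra.
Qed.

Lemma circle_norm_le x : circle_norm (circle_proj x) <= `|x|.
Proof.
rewrite circle_normE /frac ge_min.
have /andP[] := floor_itv x; rewrite intrD => fx fx1.
case: (lerP 0 x) => x0; rewrite ?(ger0_norm x0) ?(ltr0_norm x0).
  have : (0 <= (Num.floor x)%:~R :> R) by rewrite ler0z floor_ge0.
  by move=> f0; apply/orP; left; lra.
have f1 : ((Num.floor x)%:~R <= -1 :> R).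
  by rewrite (_ : -1 = (-1)%:~R :> R) ?ler_int // -ltzD1 floor_lt0.
by apply/orP; right; lra.
Qed.

Lemma circle_norm_repr t : exists2 x, circle_proj x = t & `|x| = circle_norm t.
Proof.
have [x <-] := circle_proj_surj t.
rewrite circle_normE; have /andP[f0 f1] := frac_itv x.
case: (leP (frac x) (1 - frac x)) => h.
  by exists (frac x); [exact: circle_proj_frac | rewrite ger0_norm].
exists (frac x - 1).
  rewrite raddfB /= circle_proj_frac (_ : circle_proj 1 = 0) ?subr0 //.
  by apply/eqP; rewrite -(raddf0 circle_proj) circle_proj_eq subr0.
by rewrite ler0_norm; lra.
Qed.

Lemma circle_norm_eq0 t : (circle_norm t == 0) = (t == 0).
Proof.
apply/eqP/eqP => [|->].
  have [x <- <-] := circle_norm_repr t.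
  by move/normr0_eq0 ->; rewrite raddf0.
apply/eqP; rewrite eq_le; apply/andP; split.
  by rewrite -(raddf0 circle_proj) (le_trans (circle_norm_le 0)) ?normr0.
by have [x _ <-] := circle_norm_repr 0.
Qed.

Lemma circle_normN t : circle_norm (- t) = circle_norm t.
Proof.
suff h u : circle_norm (- u) <= circle_norm u.
  by apply/eqP; rewrite eq_le h /= -{1}(opprK t) h.
have [x <- <-] := circle_norm_repr u.
by rewrite -raddfN (le_trans (circle_norm_le _)) ?normrN.
Qed.

Lemma ler_circle_normD s t :
  circle_norm (s + t) <= circle_norm s + circle_norm t.
Proof.
have [x <- <-] := circle_norm_repr s; have [y <- <-] := circle_norm_repr t.
by rewrite -raddfD (le_trans (circle_norm_le _)) ?ler_normD.
Qed.

Lemma circle_norm_complete (u : nat -> circle) :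
  (forall e, 0 < e -> exists N, forall m n,
     (N <= m)%N -> (N <= n)%N -> circle_norm (u m - u n) < e) ->
  exists l, circle_norm (u n - l) @[n --> \oo] --> (0 : R).
Proof.
move=> cu; pose x n := frac (repr (u n)).
have xE n : circle_proj (x n) = u n.
  by rewrite circle_proj_frac /circle_proj reprK.
have [c [_ xc]] : `[0, 1]%classic `&` cluster (x n @[n --> \oo]) !=set0.
  apply: (@segment_compact R 0 1); exists 0%N => // n _ /=.
  by rewrite in_itv /=; have /andP[? /ltW ?] := frac_itv (repr (u n)); apply/andP.
exists (circle_proj c); apply/cvgrPdist_lt => e e0.
have e2 : 0 < e / 2 by rewrite divr_gt0.
have [N uN] := cu (e / 2) e2.
have xN : (x n @[n --> \oo]) (x @` [set n | (N <= n)%N]).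
  by exists N => // n Nn; exists n.
have [_ [[n Nn <-] xnc]] := xc _ _ xN (nbhsx_ballx c (e / 2) e2).
exists N => // m Nm /=; rewrite sub0r normrN ger0_norm; last first.
  by have [y _ <-] := circle_norm_repr (u m - circle_proj c).
rewrite -(subrK (u n) (u m)) -addrA.
apply: le_lt_trans (ler_circle_normD _ _) _; rewrite (splitr e) ltrD ?uN //.
rewrite -(xE n) -raddfB /= (le_lt_trans (circle_norm_le _)) // distrC.
exact: xnc.
Qed.

Definition circle_group : normedGroup R :=
  NormedGroup circle_norm_eq0 circle_normN ler_circle_normD
    circle_norm_complete.

End Circle.

Section PolyhedralChains.
Context {R : realType} {d : nat}.

Definition eucl_dist (x y : 'rV[R]_d) : R := Num.sqrt (\sum_(i < d) (x 0 i - y 0 i) ^+ 2).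

Definition segment (x y : 'rV[R]_d) : set 'rV[R]_d :=
  [set x + t *: (y - x) | t in `[0, 1]%classic].

Lemma eucl_dist_ge0 x y : 0 <= eucl_dist x y.
Proof. exact: sqrtr_ge0. Qed.

Lemma eucl_distC x y : eucl_dist x y = eucl_dist y x.
Proof. by congr Num.sqrt; apply: eq_bigr => i _; rewrite -sqrrN opprB. Qed.

Lemma eucl_dist_scale x y x' y' (t : R) :
  0 <= t -> y' - x' = t *: (y - x) -> eucl_dist x' y' = t * eucl_dist x y.
Proof.
move=> t0 xyE; have {1}-> : t = Num.sqrt (t ^+ 2) by rewrite sqrtr_sqr ger0_norm.
rewrite -sqrtrM ?sqr_ge0//; congr Num.sqrt; rewrite mulr_sumr.
apply: eq_bigr => i _; move/matrixP/(_ 0 i): xyE; rewrite !mxE => xyE.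
by rewrite -sqrrN opprB xyE exprMn -(sqrrN (x _ _ - _)) opprB.
Qed.

Lemma segmentC x y : segment x y = segment y x.
Proof.
suff h u v : segment u v `<=` segment v u by apply/seteqP; split.
move=> _ [t + <-]; rewrite /= in_itv /= => /andP[t0 t1].
exists (1 - t); first by rewrite /= in_itv /=; apply/andP; split; lra.
by apply/rowP => i; rewrite !mxE; ring.
Qed.

Lemma segment_share_pos (a b c e : 'rV[R]_d) (p1 q1 p2 q2 k g : R) :
  0 <= p1 <= 1 -> 0 <= q1 <= 1 -> 0 <= p2 <= 1 -> 0 <= q2 <= 1 ->
  p1 != q1 -> p1 = g + p2 * k -> q1 = g + q2 * k -> 0 < k ->
  c = a + g *: (b - a) -> e = a + (g + k) *: (b - a) ->
  (forall t, 0 < t < 1 -> a + t *: (b - a) != c) ->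
  (forall t, 0 < t < 1 -> a + t *: (b - a) != e) ->
  (forall t, 0 < t < 1 -> c + t *: (e - c) != a) ->
  (forall t, 0 < t < 1 -> c + t *: (e - c) != b) -> a = c /\ b = e.
Proof.
move=> /andP[p1_0 p1_1] /andP[q1_0 q1_1] /andP[p2_0 p2_1] /andP[q2_0 q2_1].
move=> /eqP npq pE qE k0 cE eE nc ne na nb.
have ? : 0 <= p2 * k by rewrite mulr_ge0 // ltW.
have ? : 0 <= q2 * k by rewrite mulr_ge0 // ltW.
have ? : p2 * k <= k by rewrite -[leRHS]mul1r ler_pM2r.
have ? : q2 * k <= k by rewrite -[leRHS]mul1r ler_pM2r.
have ctE t : c + t *: (e - c) = a + (g + t * k) *: (b - a).
  by rewrite cE eE; apply/rowP => i; rewrite !mxE; ring.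
have g_le0 : g <= 0.
  rewrite leNgt; apply/negP => g_gt0; have [g1|g1] := ltP g 1.
    by have := nc g; rewrite -cE eqxx g_gt0 g1 => /(_ isT).
  by apply: npq; lra.
have gk_ge1 : 1 <= g + k.
  rewrite leNgt; apply/negP => gk_lt1; have [gk0|gk0] := ltP 0 (g + k).
    by have := ne (g + k); rewrite -eE eqxx gk0 gk_lt1 => /(_ isT).
  by apply: npq; lra.
have g0 : g = 0.
  apply/eqP; rewrite eq_le g_le0 leNgt; apply/negP => g_lt0.
  have := na (- g / k); rewrite ctE divfK ?gt_eqF // subrr scale0r addr0 eqxx.
  by rewrite divr_gt0 ?oppr_gt0 // ltr_pdivrMr // mul1r (_ : - g < k) => [/(_ isT)|]//; lra.
have k1 : k = 1.
  apply/eqP; rewrite eq_le; apply/andP; split; last by lra.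
  rewrite leNgt; apply/negP => k_gt1.
  have := nb k^-1; rewrite ctE g0 add0r mulVf ?gt_eqF // scale1r addrC subrK eqxx.
  by rewrite invr_gt0 k0 invf_lt1 // k_gt1 => /(_ isT).
by rewrite cE eE g0 k1 add0r scale0r scale1r addr0 addrC subrK.
Qed.

Lemma segment_share (a b c e p q : 'rV[R]_d) :
  segment a b p -> segment a b q -> segment c e p -> segment c e q ->
  p != q ->
  (forall t, 0 < t < 1 -> a + t *: (b - a) != c) ->
  (forall t, 0 < t < 1 -> a + t *: (b - a) != e) ->
  (forall t, 0 < t < 1 -> c + t *: (e - c) != a) ->
  (forall t, 0 < t < 1 -> c + t *: (e - c) != b) ->
  (a = c /\ b = e) \/ (a = e /\ b = c).
Proof.
move=> [p1 + pE] [q1 + qE] [p2 + pE'] [q2 + qE'].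
rewrite /= !in_itv /= => p1i q1i p2i q2i npq nc ne na nb.
have npq1 : p1 != q1 by apply: contra_neq npq; rewrite -pE -qE => ->.
have npq2 : p2 != q2 by apply: contra_neq npq; rewrite -pE' -qE' => ->.
pose k := (q1 - p1) / (q2 - p2); pose g := p1 - p2 * k.
have d2 : q2 - p2 != 0 by rewrite subr_eq0 eq_sym.
have k0 : k != 0 by rewrite mulf_neq0 ?invr_eq0 // subr_eq0 eq_sym.
have pE1 : p1 = g + p2 * k by rewrite /g subrK.
have qE1 : q1 = g + q2 * k by rewrite /g /k; field.
have ecE : e - c = k *: (b - a).
  apply/rowP => i; rewrite /k !mxE.
  move: pE qE; rewrite -pE' -qE' => /rowP/(_ i) + /rowP/(_ i).
  rewrite !mxE => h1 h2.
  have h : (q1 - p1) * (b 0 i - a 0 i) = (q2 - p2) * (e 0 i - c 0 i) by lra.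
  by rewrite mulrAC h; field.
have cE : c = a + g *: (b - a).
  by rewrite /g scalerBl addrA pE -scalerA -ecE -pE' addrK.
have eE : e = a + (g + k) *: (b - a).
  by rewrite scalerDl -ecE addrA -cE addrC subrK.
have [k_lt0|k_gt0|/eqP] := ltgtP k 0; last by rewrite (negPf k0).
  right; apply: (@segment_share_pos a b e c p1 q1 (1 - p2) (1 - q2) (- k) (g + k)) => //.
  - by move: p2i => /andP[? ?]; apply/andP; split; lra.
  - by move: q2i => /andP[? ?]; apply/andP; split; lra.
  - by rewrite pE1; ring.
  - by rewrite qE1; ring.
  - by rewrite oppr_gt0.
  - by rewrite addrK.
  - move=> t /andP[t0 t1]; have := na (1 - t); rewrite (_ : 0 < 1 - t < 1).
      move=> /(_ isT); apply: contra_neq => <-.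
      by apply/rowP => i; rewrite !mxE; ring.
    by apply/andP; split; lra.
  - move=> t /andP[t0 t1]; have := nb (1 - t); rewrite (_ : 0 < 1 - t < 1).
      move=> /(_ isT); apply: contra_neq => <-.
      by apply/rowP => i; rewrite !mxE; ring.
    by apply/andP; split; lra.
by left; apply: (@segment_share_pos a b c e p1 q1 p2 q2 k g).
Qed.

Variable K : set 'rV[R]_d.

Record simplex1 := Simplex1 {
  src : K;
  tgt : K;
  src_neq_tgt : src != tgt;
  segment_sub : segment (val src) (val tgt) `<=` K }.

Definition support1 (s : simplex1) := segment (val (src s)) (val (tgt s)).

(* H^1 of a segment is its Euclidean length. The library norm on 'rV is the sup
   norm, whence [eucl_dist]. *)
Definition length1 (s : simplex1) := eucl_dist (val (src s)) (val (tgt s)).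

(* Two segments meet in an H^1-null set iff they share at most one point. *)
Definition nonoverlap1 (s t : simplex1) : bool :=
  `[< is_subset1 (support1 s `&` support1 t) >].

Definition inner1 (s : simplex1) (x : K) : bool :=
  `[< exists2 t : R, 0 < t < 1 &
      val (src s) + t *: (val (tgt s) - val (src s)) = val x >].

Lemma simplex1_param_inj (s : simplex1) (t u : R) :
  val (src s) + t *: (val (tgt s) - val (src s)) =
  val (src s) + u *: (val (tgt s) - val (src s)) -> t = u.
Proof.
move=> /addrI/eqP; rewrite -subr_eq0 -scalerBl scaler_eq0 !subr_eq0.
by move=> /orP[/eqP //|/eqP/val_inj/eqP]; rewrite eq_sym (negPf (src_neq_tgt s)).
Qed.

Lemma split_simplex1 (s : simplex1) (x : K) : inner1 s x ->
  exists s1 s2 : simplex1,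
    [/\ src s1 = src s, tgt s1 = x, src s2 = x, tgt s2 = tgt s &
     length1 s1 + length1 s2 = length1 s /\
     forall y, (inner1 s1 y + inner1 s2 y + (y == x) <= inner1 s y)%N].
Proof.
move=> /asboolP[t /andP[t0 t1] xE].
set a := val (src s) in xE *; set b := val (tgt s) in xE *.
have sub1 : segment a (val x) `<=` K.
  apply: subset_trans (@segment_sub s) => _ [u + <-].
  rewrite /= in_itv /= => /andP[u0 u1]; exists (u * t).
    by rewrite /= in_itv /= mulr_ge0 ?(ltW t0) //= mulr_ile1 // ltW.
  by rewrite -xE -/a -/b addrAC subrr add0r scalerA.
have x2E u : val x + u *: (b - val x) = a + (t + u * (1 - t)) *: (b - a).
  by rewrite -xE; apply/rowP => i; rewrite !mxE; ring.
have sub2 : segment (val x) b `<=` K.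
  apply: subset_trans (@segment_sub s) => _ [u + <-].
  rewrite /= in_itv /= => /andP[u0 u1]; exists (t + u * (1 - t)).
    rewrite /= in_itv /=; have ? : 0 <= u * (1 - t) by rewrite mulr_ge0 // subr_ge0 ltW.
    have ? : u * (1 - t) <= 1 - t by rewrite -[leRHS]mul1r ler_wpM2r // subr_ge0 ltW.
    by apply/andP; split; lra.
  by rewrite x2E.
have sx : src s != x.
  apply: contraTneq t0 => sx; rewrite -leNgt; suff -> : t = 0 by [].
  by apply: (@simplex1_param_inj s); rewrite -/a -/b xE -sx scale0r addr0.
have xt : x != tgt s.
  apply: contraTneq t1 => sx'; rewrite -leNgt; suff -> : t = 1 by [].
  by apply: (@simplex1_param_inj s); rewrite -/a -/b xE sx' scale1r addrC subrK.
pose s1 := Simplex1 sx sub1; pose s2 := Simplex1 xt sub2.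
exists s1, s2; split=> //; split.
  rewrite /length1 /= -/a -/b (@eucl_dist_scale a b a (val x) t) ?ltW //; last first.
    by rewrite -xE addrAC subrr add0r.
  rewrite (@eucl_dist_scale a b (val x) b (1 - t)) ?subr_ge0 ?ltW //; last first.
    by rewrite -xE; apply/rowP => i; rewrite !mxE; ring.
  by rewrite -mulrDl addrC subrK mul1r.
move=> y.
have in1 : inner1 s1 y -> exists2 r, 0 < r < t & a + r *: (b - a) = val y.
  move=> /asboolP[u /andP[u0 u1] /= <-]; exists (u * t).
    by rewrite mulr_gt0 //= gtr_pMl.
  by rewrite -xE -/a addrAC subrr add0r scalerA.
have in2 : inner1 s2 y -> exists2 r, t < r < 1 & a + r *: (b - a) = val y.
  move=> /asboolP[u /andP[u0 u1] /= <-]; exists (t + u * (1 - t)).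
    have ? : 0 < u * (1 - t) by rewrite mulr_gt0 // subr_gt0.
    have ? : u * (1 - t) < 1 - t by rewrite gtr_pMl // subr_gt0.
    by apply/andP; split; lra.
  by rewrite -/b x2E.
have in3 : y == x -> a + t *: (b - a) = val y by move=> /eqP ->.
have uniq r r' : a + r *: (b - a) = val y -> a + r' *: (b - a) = val y -> r = r'.
  by move=> h1 h2; apply: (@simplex1_param_inj s); rewrite -/a -/b h1 h2.
have in0 r : 0 < r < 1 -> a + r *: (b - a) = val y -> inner1 s y.
  by move=> r01 rE; apply/asboolP; exists r.
case: (boolP (inner1 s1 y)) => [/in1[r1 /andP[r1a r1b] r1E]|_].
  have -> : inner1 s2 y = false.
    apply/negP => /in2[r2 /andP[r2a r2b] /(uniq _ _ r1E) r12]; lra.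
  have -> : (y == x) = false.
    apply/negP => /in3/(uniq _ _ r1E); lra.
  by rewrite (in0 r1) //; apply/andP; split; lra.
case: (boolP (inner1 s2 y)) => [/in2[r2 /andP[r2a r2b] r2E]|_].
  have -> : (y == x) = false.
    apply/negP => /in3/(uniq _ _ r2E); lra.
  by rewrite (in0 r2) //; apply/andP; split; lra.
case: (boolP (y == x)) => // /in3 tE.
by rewrite (in0 t) // t0 t1.
Qed.

Lemma nonoverlap1_good (X : seq K) (s t : simplex1) :
  src s \in X -> tgt s \in X -> ~~ has (inner1 s) X ->
  src t \in X -> tgt t \in X -> ~~ has (inner1 t) X ->
  [\/ nonoverlap1 s t, src s = src t /\ tgt s = tgt t |
      src s = tgt t /\ tgt s = src t].
Proof.
move=> sX1 sX2 /hasPn sX tX1 tX2 /hasPn tX.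
have [|/asboolP] := boolP (nonoverlap1 s t); first by move=> ?; constructor 1.
move=> /existsNP[p /existsNP[q]] /not_implyP[[sp tp]] /not_implyP[[sq tq]] /eqP npq.
have in_out (s' : simplex1) y : (forall x, x \in X -> ~~ inner1 s' x) -> y \in X ->
    forall u : R, 0 < u < 1 ->
    val (src s') + u *: (val (tgt s') - val (src s')) != val y.
  move=> s'X yX u u01; apply: contraNneq (s'X y yX) => uE.
  by apply/asboolP; exists u.
have [|] := segment_share sp sq tp tq npq (in_out _ _ sX tX1) (in_out _ _ sX tX2)
  (in_out _ _ tX sX1) (in_out _ _ tX sX2).
- by move=> [/val_inj ? /val_inj ?]; constructor 2.
- by move=> [/val_inj ? /val_inj ?]; constructor 3.
Qed.

Lemma nonoverlap1C s t : nonoverlap1 s t = nonoverlap1 t s.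
Proof. by rewrite /nonoverlap1 setIC. Qed.

Section Coefficients.
Variable G : normedGroup R.

Definition chain0_pred : {pred K -> G} :=
  [pred f | `[< finite_set [set x | f x != 0] >]].

(* Polyhedral 0-chains: the finitely many g_l sit at distinct points, and the
   0-simplex -[p] carries -g, so a chain is its coefficient function on
   the points of K. *)
Record chain0 := Chain0 { coef0 :> K -> G; _ : chain0_pred coef0 }.

Lemma chain0_zmod_closed : zmod_closed chain0_pred.
Proof.
split=> [|f g /asboolP ff /asboolP fg]; apply/asboolP.
  by apply: sub_finite_set (finite_set0 _) => x /=; rewrite eqxx.
apply: sub_finite_set (_ : finite_set ([set x | f x != 0] `|` [set x | g x != 0])).
  move=> x /= fgx; apply/orP; apply: contraNT fgx.
  rewrite negb_or !negbK => /andP[/eqP fx /eqP gx].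
  by rewrite -[_ x]/(f x - g x) fx gx subr0.
by rewrite finite_setU.
Qed.

HB.instance Definition _ := GRing.isZmodClosed.Build _ chain0_pred
  chain0_zmod_closed.
HB.instance Definition _ := [isSub for coef0].
HB.instance Definition _ := [Choice of chain0 by <:].
HB.instance Definition _ := [SubChoice_isSubZmodule of chain0 by <:].

Lemma point_chain_subproof (p : K) (g : G) :
  chain0_pred (fun x => if x == p then g else 0).
Proof.
apply/asboolP/(sub_finite_set _ (finite_set1 p)) => x /=.
by case: (x =P p) => // _; rewrite eqxx.
Qed.

Definition point_chain p g := Chain0 (point_chain_subproof p g).

(* H^0 of a point is 1. *)
Definition mass0 (P : chain0) : R := \sum_(x \in [set: K]) gnorm (P x).

(* Representatives of polyhedral 1-chains. Reversing orientations and refining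
   change neither [mass1] nor [boundary1], so the infimum in [flat_norm] may be
   taken over representatives. *)
Record chain1 := Chain1 {
  terms1 :> seq (G * simplex1);
  nonoverlapping1 : pairwise nonoverlap1 [seq s.2 | s <- terms1] }.

Definition mass1 (Q : seq (G * simplex1)) : R :=
  \sum_(s <- Q) gnorm s.1 * length1 s.2.

Definition boundary1 (Q : seq (G * simplex1)) : chain0 :=
  \sum_(s <- Q) (point_chain (tgt s.2) s.1 - point_chain (src s.2) s.1).

Definition flat_norm (P : chain0) : R :=
  inf [set mass1 Q + mass0 (P - boundary1 Q) | Q in [set: chain1]].

Lemma mass0E (P : chain0) (A : set K) :
  (forall x, ~ A x -> P x = 0) -> mass0 P = \sum_(x \in A) gnorm (P x).
Proof.
move=> PA; apply/esym/fsbig_widen => // x [_ Ax] /=.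
by rewrite /preimage /= PA ?gnorm0.
Qed.

Lemma chain0_finite (P : chain0) : finite_set [set x | P x != 0].
Proof. by case: P => f /= /asboolP. Qed.

Lemma mass0_ge0 P : 0 <= mass0 P.
Proof. by apply: fsumr_ge0 => x _; exact: gnorm_ge0. Qed.

Lemma mass0N P : mass0 (- P) = mass0 P.
Proof. by apply: eq_fsbigr => x _; rewrite -[(- P) x]/(- P x) gnormN. Qed.

Lemma ler_mass0D P Q : mass0 (P + Q) <= mass0 P + mass0 Q.
Proof.
pose A := [set x | P x != 0] `|` [set x | Q x != 0].
have fA : finite_set A by rewrite finite_setU; split; exact: chain0_finite.
have P0 x : ~ A x -> P x = 0 by move=> /not_orP[/negP/negPn/eqP].
have Q0 x : ~ A x -> Q x = 0 by move=> /not_orP[_ /negP/negPn/eqP].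
rewrite !(@mass0E _ A) // => [|x Ax]; last first.
  by rewrite -[(P + Q) x]/(P x + Q x) P0 ?Q0 ?addr0.
rewrite !fsbig_finite // -big_split /=; apply: ler_sum => x _; exact: ler_gnormD.
Qed.

Lemma mass0_0 : mass0 0 = 0.
Proof. by apply: fsbig1 => x _; exact: gnorm0. Qed.

Lemma mass1_ge0 Q : 0 <= mass1 Q.
Proof.
by apply: sumr_ge0 => s _; rewrite mulr_ge0 ?gnorm_ge0 ?eucl_dist_ge0.
Qed.

Lemma point_chainB p g h : point_chain p (g - h) = point_chain p g - point_chain p h.
Proof.
apply/val_inj/funext => x.
rewrite -[RHS]/((if x == p then g else 0) - (if x == p then h else 0)) /=.
by case: eqP; rewrite ?subr0.
Qed.
HB.instance Definition _ p := GRing.isZmodMorphism.Build G chain0 (point_chain p)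
  (point_chainB p).

Lemma mass1_cat Q Q' : mass1 (Q ++ Q') = mass1 Q + mass1 Q'.
Proof. exact: big_cat. Qed.

Lemma boundary1_cat Q Q' : boundary1 (Q ++ Q') = boundary1 Q + boundary1 Q'.
Proof. exact: big_cat. Qed.

Lemma mass1_cons s Q : mass1 (s :: Q) = gnorm s.1 * length1 s.2 + mass1 Q.
Proof. exact: big_cons. Qed.

Lemma boundary1_cons s Q : boundary1 (s :: Q) =
  (point_chain (tgt s.2) s.1 - point_chain (src s.2) s.1) + boundary1 Q.
Proof. exact: big_cons. Qed.

Let good (X : seq K) (s : simplex1) : bool :=
  [&& src s \in X, tgt s \in X & ~~ has (inner1 s) X].

Lemma subdivide_simplex1 (X : seq K) n (g : G) (s : simplex1) :
  (count (inner1 s) X <= n)%N -> src s \in X -> tgt s \in X ->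
  exists Q : seq (G * simplex1),
    [/\ all (good X) [seq q.2 | q <- Q],
        boundary1 Q = boundary1 [:: (g, s)] & mass1 Q = mass1 [:: (g, s)]].
Proof.
elim: n s => [|n IH] s cs sX tX.
  by exists [:: (g, s)]; rewrite /= /good sX tX has_count -leqNgt cs.
have [/hasP[x xX sx]|nsX] := boolP (has (inner1 s) X); last first.
  by exists [:: (g, s)]; rewrite /= /good sX tX nsX.
have [s1 [s2 [s1a s1b s2a s2b [len inn]]]] := split_simplex1 sx.
have cX Y : (count (inner1 s1) Y + count (inner1 s2) Y + count_mem x Y <=
    count (inner1 s) Y)%N.
  by elim: Y => //= y Y IHY; have := inn y; lia.
have x0 : (0 < count_mem x X)%N by rewrite -has_count has_pred1.
have [||| Q1 [g1 b1 m1]] := IH s1; rewrite ?s1a ?s1b //; first by have := cX X; lia.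
have [||| Q2 [g2 b2 m2]] := IH s2; rewrite ?s2a ?s2b //; first by have := cX X; lia.
exists (Q1 ++ Q2); split; first by rewrite map_cat all_cat g1.
  rewrite boundary1_cat b1 b2 /boundary1 !big_seq1 /= s1a s1b s2a s2b.
  by rewrite addrC addrA subrK.
by rewrite mass1_cat m1 m2 /mass1 !big_seq1 /= -mulrDr len.
Qed.

Lemma subdivide1 (Q : seq (G * simplex1)) :
  exists X (Q' : seq (G * simplex1)),
    [/\ all (good X) [seq q.2 | q <- Q'],
        boundary1 Q' = boundary1 Q & mass1 Q' = mass1 Q].
Proof.
pose X := [seq src q.2 | q <- Q] ++ [seq tgt q.2 | q <- Q]; exists X.
have : all (mem X) [seq src q.2 | q <- Q] && all (mem X) [seq tgt q.2 | q <- Q].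
  by apply/andP; split; apply/allP => x xQ; rewrite inE mem_cat xQ ?orbT.
elim: Q {X} (X) => [|[g s] Q IH] X /=; first by exists [::].
move=> /andP[/andP[sX sQ] /andP[tX tQ]].
have [Q' [gQ' bQ' mQ']] := IH X (introT andP (conj sQ tQ)).
have [Q1 [gQ1 bQ1 mQ1]] := subdivide_simplex1 g (leqnn _) sX tX.
exists (Q1 ++ Q'); split; first by rewrite map_cat all_cat gQ1.
  by rewrite boundary1_cat bQ1 bQ' /boundary1 big_seq1 big_cons.
by rewrite mass1_cat mQ1 mQ' /mass1 big_seq1 big_cons.
Qed.

Lemma insert_simplex1 (X : seq K) (g : G) (s : simplex1) (Q : seq (G * simplex1)) :
  good X s -> all (good X) [seq q.2 | q <- Q] ->
  pairwise nonoverlap1 [seq q.2 | q <- Q] ->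
  exists Q' : seq (G * simplex1),
    [/\ pairwise nonoverlap1 [seq q.2 | q <- Q'],
        forall p : pred simplex1, p s -> all p [seq q.2 | q <- Q] ->
          all p [seq q.2 | q <- Q'],
        boundary1 Q' = boundary1 ((g, s) :: Q) &
        mass1 Q' <= mass1 ((g, s) :: Q)].
Proof.
move=> gs; elim: Q => [|[h t] Q IH] /=.
  by move=> _ _; exists [:: (g, s)]; split=> //= p ->.
move=> /andP[gt gQ] /andP[tQ nQ].
move: (gs) (gt) => /and3P[s1 s2 s3] /and3P[t1 t2 t3].
have [nst|[sE tE]|[sE tE]] := nonoverlap1_good s1 s2 s3 t1 t2 t3.
- have [Q' [nQ' pQ' bQ' mQ']] := IH gQ nQ.
  exists ((h, t) :: Q'); split=> /=.
  + by rewrite nQ' andbT pQ' // nonoverlap1C.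
  + by move=> p ps /andP[-> pQ]; rewrite pQ'.
  + by rewrite boundary1_cons bQ' !boundary1_cons addrCA.
  + by rewrite mass1_cons (le_trans (lerD (lexx _) mQ')) // !mass1_cons addrCA.
- exists ((g + h, t) :: Q); split=> //=; first by rewrite tQ.
    have pD p : point_chain p (g + h) = point_chain p g + point_chain p h.
      exact: raddfD.
    by rewrite !boundary1_cons /= sE tE !pD opprD addrACA -!addrA.
  rewrite !mass1_cons /= addrA lerD2r /length1 sE tE -mulrDl.
  by rewrite ler_wpM2r ?eucl_dist_ge0 ?ler_gnormD.
- exists ((h - g, t) :: Q); split=> //=; first by rewrite tQ.
    rewrite !boundary1_cons /= sE tE !point_chainB addrA; congr (_ + _).
    by rewrite opprB [LHS]addrC addrACA [RHS]addrACA; congr (_ + _); rewrite addrC.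
  rewrite !mass1_cons /= addrA lerD2r /length1 sE tE eucl_distC -mulrDl.
  by rewrite ler_wpM2r ?eucl_dist_ge0 // addrC (le_trans (ler_gnormD _ _)) ?gnormN.
Qed.

Lemma refine1 (Q : seq (G * simplex1)) :
  exists Q' : chain1, boundary1 Q' = boundary1 Q /\ mass1 Q' <= mass1 Q.
Proof.
have [X [Q1 [gQ1 <- <-]]] := subdivide1 Q.
suff [Q' [nQ' _ bQ' mQ']] : exists Q' : seq (G * simplex1),
    [/\ pairwise nonoverlap1 [seq q.2 | q <- Q'],
        all (good X) [seq q.2 | q <- Q'], boundary1 Q' = boundary1 Q1 &
        mass1 Q' <= mass1 Q1].
  by exists (Chain1 nQ').
elim: Q1 gQ1 => [|[g s] Q1 IH] /=; first by exists [::].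
move=> /andP[gs /IH[Q' [nQ' gQ' bQ' mQ']]].
have [Q2 [nQ2 pQ2 bQ2 mQ2]] := insert_simplex1 g gs gQ' nQ'.
exists Q2; split=> //; first exact: pQ2.
  by rewrite bQ2 !boundary1_cons bQ'.
by rewrite (le_trans mQ2) // !mass1_cons lerD2l.
Qed.

Lemma flat_norm_lbound P :
  has_lbound [set mass1 Q + mass0 (P - boundary1 Q) | Q in [set: chain1]].
Proof. by exists 0 => _ [Q _ <-]; rewrite addr_ge0 ?mass1_ge0 ?mass0_ge0. Qed.

Lemma chain1_nil_subproof :
  pairwise nonoverlap1 [seq s.2 | s <- ([::] : seq (G * simplex1))].
Proof. by []. Qed.

Lemma flat_norm_inf P :
  has_inf [set mass1 Q + mass0 (P - boundary1 Q) | Q in [set: chain1]].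
Proof.
split; last exact: flat_norm_lbound.
by exists (mass1 (Chain1 chain1_nil_subproof) +
  mass0 (P - boundary1 (Chain1 chain1_nil_subproof))), (Chain1 chain1_nil_subproof).
Qed.

Lemma flat_norm_le P (Q : seq (G * simplex1)) :
  flat_norm P <= mass1 Q + mass0 (P - boundary1 Q).
Proof.
have [Q' [bQ' mQ']] := refine1 Q.
apply: le_trans (_ : mass1 Q' + mass0 (P - boundary1 Q') <= _).
  by apply: ge_inf; [exact: flat_norm_lbound | exists Q'].
by rewrite bQ' lerD2r.
Qed.

Lemma flat_norm_le_mass0 P : flat_norm P <= mass0 P.
Proof.
by have := flat_norm_le P [::]; rewrite /mass1 /boundary1 !big_nil add0r subr0.
Qed.

Lemma flat_norm_approx P (e : R) : 0 < e ->
  exists Q : chain1, mass1 Q + mass0 (P - boundary1 Q) < flat_norm P + e.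
Proof.
by move=> e0; have [_ [Q _ <-] Qe] := inf_adherent e0 (flat_norm_inf P); exists Q.
Qed.

Lemma flat_norm_ge0 P : 0 <= flat_norm P.
Proof.
apply: lb_le_inf; first by have [] := flat_norm_inf P.
by move=> _ [Q _ <-]; rewrite addr_ge0 ?mass1_ge0 ?mass0_ge0.
Qed.

Lemma flat_norm0 : flat_norm 0 = 0.
Proof.
by apply/eqP; rewrite eq_le flat_norm_ge0 (le_trans (flat_norm_le_mass0 _)) ?mass0_0.
Qed.

Lemma ler_flat_normD P P' : flat_norm (P + P') <= flat_norm P + flat_norm P'.
Proof.
apply/ler_addgt0Pr => e e0; have e2 : 0 < e / 2 by rewrite divr_gt0.
have [Q Qe] := flat_norm_approx P e2; have [Q' Qe'] := flat_norm_approx P' e2.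
apply: le_trans (flat_norm_le _ (Q ++ Q')) _.
rewrite mass1_cat boundary1_cat opprD addrACA.
have := ler_mass0D (P - boundary1 Q) (P' - boundary1 Q'); lra.
Qed.

Lemma flat_normN P : flat_norm (- P) = flat_norm P.
Proof.
suff h P' : flat_norm (- P') <= flat_norm P'.
  by apply/eqP; rewrite eq_le h /= -{1}(opprK P) h.
apply/ler_addgt0Pr => e e0; have [Q /ltW Qe] := flat_norm_approx P' e0.
apply: le_trans Qe; pose NQ : seq (G * simplex1) := [seq (- q.1, q.2) | q <- Q].
have -> : mass1 Q = mass1 NQ.
  by rewrite /mass1 big_map; apply: eq_bigr => q _ /=; rewrite gnormN.
have bNQ : boundary1 NQ = - boundary1 Q.
  rewrite /boundary1 big_map -sumrN; apply: eq_bigr => q _ /=.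
  by rewrite !raddfN /= opprB opprK addrC.
apply: le_trans (flat_norm_le _ NQ) _; rewrite bNQ lerD2l -mass0N.
by rewrite opprD !opprK.
Qed.

Lemma flat_normBC P P' : flat_norm (P - P') = flat_norm (P' - P).
Proof. by rewrite -flat_normN opprB. Qed.

Lemma ler_dist_flat_norm P P' : `|flat_norm P - flat_norm P'| <= flat_norm (P - P').
Proof.
have := ler_flat_normD (P - P') P'; have := ler_flat_normD (P' - P) P.
rewrite !subrK (flat_normBC P' P) => h1 h2.
by rewrite ler_norml lerNl opprB !lerBlDr h1 h2.
Qed.

End Coefficients.
End PolyhedralChains.

Section FlatChains.
Context {R : realType} {d : nat}.
Variables (K : set 'rV[R]_d) (G : normedGroup R).

(* The completion is built as Cauchy sequences modulo null sequences. *)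
Definition flat_cauchy_pred : {pred nat -> chain0 K G} :=
  [pred u | `[< forall e : R, 0 < e -> exists N, forall m n,
     (N <= m)%N -> (N <= n)%N -> flat_norm (u m - u n) < e >]].

Record flat_cauchy :=
  FlatCauchy { cauchy_seq :> nat -> chain0 K G; _ : flat_cauchy_pred cauchy_seq }.

Lemma flat_cauchy_zmod_closed : zmod_closed flat_cauchy_pred.
Proof.
split=> [|u v /asboolP cu /asboolP cv]; apply/asboolP => e e0.
  by exists 0%N => m n _ _; rewrite subr0 flat_norm0.
have e2 : 0 < e / 2 by rewrite divr_gt0.
have [M Mu] := cu _ e2; have [N Nv] := cv _ e2.
exists (maxn M N) => m n; rewrite !geq_max => /andP[? ?] /andP[? ?].
rewrite -[(u - v) m]/(u m - v m) -[(u - v) n]/(u n - v n) opprD addrACA.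
rewrite -opprD (splitr e); apply: le_lt_trans (ler_flat_normD _ _) _.
by rewrite flat_normN; apply: ltrD; [exact: Mu | exact: Nv].
Qed.

HB.instance Definition _ := GRing.isZmodClosed.Build _ flat_cauchy_pred
  flat_cauchy_zmod_closed.
HB.instance Definition _ := [isSub for cauchy_seq].
HB.instance Definition _ := [Choice of flat_cauchy by <:].
HB.instance Definition _ := [SubChoice_isSubZmodule of flat_cauchy by <:].

Definition flat_null : {pred flat_cauchy} :=
  [pred u : flat_cauchy | `[< flat_norm (u n) @[n --> \oo] --> (0 : R) >]].

Lemma flat_null_zmod_closed : zmod_closed flat_null.
Proof.
split=> [|u v /asboolP u0 /asboolP v0]; apply/asboolP.
  by under eq_cvg do rewrite flat_norm0; exact: cvg_cst.
have uv0 : flat_norm (u n) + flat_norm (v n) @[n --> \oo] --> (0 : R).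
  by rewrite -[X in _ --> X]addr0; exact: cvgD.
apply: squeeze_cvgr uv0; last exact: cvg_cst.
by near=> n; rewrite flat_norm_ge0 (le_trans (ler_flat_normD _ _)) ?flat_normN.
Unshelve. all: by end_near. Qed.

HB.instance Definition _ := GRing.isZmodClosed.Build _ flat_null
  flat_null_zmod_closed.

Definition flat_chain : zmodType :=
  Quotient.quot (GRing.ZmodClosed.clone flat_cauchy flat_null _).

Definition flat_lim (u : flat_cauchy) : flat_chain := \pi u.

Lemma flat_cst_subproof (P : chain0 K G) : flat_cauchy_pred (fun=> P).
Proof. by apply/asboolP => e e0; exists 0%N => m n _ _; rewrite subrr flat_norm0. Qed.

Definition flat_of_poly (P : chain0 K G) : flat_chain :=
  flat_lim (FlatCauchy (flat_cst_subproof P)).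

(* Extension of [flat_norm] to the completion *)
Definition fnorm (T : flat_chain) : R := limn (fun n => flat_norm (repr T n)).

Definition mass (T : flat_chain) : \bar R :=
  ereal_inf [set limn_einf (fun n => (mass0 (P n))%:E) |
    P in [set P : nat -> chain0 K G |
      fnorm (flat_of_poly (P n) - T) @[n --> \oo] --> (0 : R)]].

Lemma flat_lim_is_zmod_morphism : zmod_morphism flat_lim.
Proof. by move=> u v; rewrite /flat_lim raddfB. Qed.
HB.instance Definition _ := GRing.isZmodMorphism.Build flat_cauchy flat_chain
  flat_lim flat_lim_is_zmod_morphism.

Lemma flat_lim_eq u v : flat_lim u = flat_lim v <->
  flat_norm (u n - v n) @[n --> \oo] --> (0 : R).
Proof.
rewrite (rwP eqP) /flat_lim -Quotient.idealrBE.
by split=> [/asboolP|?]; last exact/asboolP.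
Qed.

Lemma flat_limP T : exists u, flat_lim u = T.
Proof. by exists (repr T); rewrite /flat_lim reprK. Qed.

Lemma is_cvg_flat_norm (u : flat_cauchy) : cvgn (fun n => flat_norm (u n)).
Proof.
case: u => u /= /asboolP cu.
apply/cauchy_cvgP/cauchy_exP => e e0; have [N uN] := cu e e0.
exists (flat_norm (u N)), N => // n Nn /=.
by apply: le_lt_trans (ler_dist_flat_norm _ _) (uN _ _ _ Nn).
Qed.

Lemma fnorm_lim (u : flat_cauchy) :
  flat_norm (u n) @[n --> \oo] --> fnorm (flat_lim u).
Proof.
rewrite /fnorm; set v := repr (flat_lim u).
have /flat_lim_eq uv : flat_lim u = flat_lim v by rewrite /flat_lim reprK.
have vl : flat_norm (v n) @[n --> \oo] --> limn (fun n => flat_norm (v n)).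
  exact: is_cvg_flat_norm.
rewrite -[X in _ --> X]subr0.
suff d0 : flat_norm (v n) - flat_norm (u n) @[n --> \oo] --> (0 : R).
  rewrite (_ : (fun n => flat_norm (u n)) =
    (fun n => flat_norm (v n) - (flat_norm (v n) - flat_norm (u n)))).
    exact: cvgB.
  by apply/funext => n; rewrite subKr.
apply/norm_cvg0P; apply: squeeze_cvgr uv; last exact: cvg_cst.
near=> n; rewrite normr_ge0 flat_normBC; exact: ler_dist_flat_norm.
Unshelve. all: by end_near. Qed.

Arguments fnorm_lim : clear implicits.

Lemma fnormE (u : flat_cauchy) :
  fnorm (flat_lim u) = limn (fun n => flat_norm (u n)).
Proof. by apply/esym/cvg_lim; [exact: Rhausdorff | exact: fnorm_lim]. Qed.

Lemma fnorm_flat_of_poly P : fnorm (flat_of_poly P) = flat_norm P.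
Proof.
by rewrite fnormE; apply: cvg_lim => /=; [exact: Rhausdorff | exact: cvg_cst].
Qed.

Lemma flat_of_poly_is_zmod_morphism : zmod_morphism flat_of_poly.
Proof. by move=> P Q; rewrite /flat_of_poly -raddfB; congr flat_lim; exact/val_inj. Qed.
HB.instance Definition _ := GRing.isZmodMorphism.Build (chain0 K G) flat_chain
  flat_of_poly flat_of_poly_is_zmod_morphism.

Lemma fnorm_ge0 T : 0 <= fnorm T.
Proof.
have [u <-] := flat_limP T; rewrite fnormE.
apply: limr_ge; first exact: is_cvg_flat_norm.
by apply: nearW => n; exact: flat_norm_ge0.
Qed.

Lemma fnorm_eq0 T : (fnorm T == 0) = (T == 0).
Proof.
have [u <-] := flat_limP T; apply/eqP/eqP => [u0|->]; last first.
  by rewrite -(raddf0 flat_of_poly) fnorm_flat_of_poly flat_norm0.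
rewrite -(raddf0 flat_lim); apply/flat_lim_eq; rewrite -[X in _ --> X]u0.
by under eq_cvg do rewrite subr0; exact: fnorm_lim.
Qed.

Lemma fnormN T : fnorm (- T) = fnorm T.
Proof.
have [u <-] := flat_limP T; rewrite -raddfN !fnormE.
rewrite (_ : (fun n => flat_norm ((- u) n)) = fun n => flat_norm (u n)) //.
by apply/funext => n; exact: flat_normN.
Qed.

Lemma ler_fnormD S T : fnorm (S + T) <= fnorm S + fnorm T.
Proof.
have [u <-] := flat_limP S; have [v <-] := flat_limP T; rewrite -raddfD /=.
apply: (ler_cvg_to (fnorm_lim (u + v)) (cvgD (fnorm_lim u) (fnorm_lim v))).
by apply: nearW => n; exact: ler_flat_normD.
Qed.

Lemma fnormBC S T : fnorm (S - T) = fnorm (T - S).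
Proof. by rewrite -fnormN opprB. Qed.

Lemma ler_fnorm_dist S T U : fnorm (S - U) <= fnorm (S - T) + fnorm (T - U).
Proof. by rewrite -[in leLHS](subrK T S) -addrA; exact: ler_fnormD. Qed.

Lemma flat_cauchy_cvg (u : flat_cauchy) :
  fnorm (flat_of_poly (u n) - flat_lim u) @[n --> \oo] --> (0 : R).
Proof.
apply/cvgrPdist_le => e e0.
have /asboolP/(_ e e0)[N uN] : flat_cauchy_pred u by case: (u).
exists N => // m Nm /=; rewrite sub0r normrN ger0_norm ?fnorm_ge0 //.
rewrite /flat_of_poly -raddfB; apply: (ler_cvg_to (fnorm_lim _) (cvg_cst e)).
by exists N => // n Nn /=; apply/ltW/uN.
Qed.

Arguments flat_cauchy_cvg : clear implicits.

Lemma flat_of_poly_dense (T : flat_chain) (e : R) : 0 < e ->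
  exists P, fnorm (flat_of_poly P - T) < e.
Proof.
move=> e0; have [u <-] := flat_limP T.
have /cvgrPdist_lt/(_ e e0)[N _ /(_ N (leqnn N))] := flat_cauchy_cvg u.
by rewrite /= sub0r normrN ger0_norm ?fnorm_ge0 // => ?; exists (u N).
Qed.

Lemma flat_chain_complete (T : nat -> flat_chain) :
  (forall e : R, 0 < e -> exists N, forall m n,
     (N <= m)%N -> (N <= n)%N -> fnorm (T m - T n) < e) ->
  exists S, fnorm (T n - S) @[n --> \oo] --> (0 : R).
Proof.
move=> cT; have /choice[P PT] n : exists P, fnorm (flat_of_poly P - T n) < n.+1%:R^-1.
  exact: flat_of_poly_dense.
have inv0 (e : R) : 0 < e -> exists N, forall n, (N <= n)%N -> n.+1%:R^-1 < e.
  by move=> e0; have [N _ Ne] := near_infty_natSinv_lt (PosNum e0); exists N.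
have cP : flat_cauchy_pred P.
  apply/asboolP => e e0; have e3 : 0 < e / 3 by rewrite divr_gt0.
  have [M Me] := inv0 _ e3; have [N Ne] := cT _ e3.
  exists (maxn M N) => m n; rewrite !geq_max => /andP[Mm Nm] /andP[Mn Nn].
  rewrite -fnorm_flat_of_poly raddfB /=.
  rewrite (_ : e = e / 3 + (e / 3 + e / 3)); last by field.
  apply: le_lt_trans (ler_fnorm_dist _ (T m) _) _; apply: ltrD.
    exact: lt_trans (PT m) (Me _ Mm).
  apply: le_lt_trans (ler_fnorm_dist _ (T n) _) _; apply: ltrD; first exact: Ne.
  by rewrite fnormBC; exact: lt_trans (PT n) (Me _ Mn).
exists (flat_lim (FlatCauchy cP)); apply/cvgrPdist_lt => e e0.
have e2 : 0 < e / 2 by rewrite divr_gt0.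
have [M Me] := inv0 _ e2.
have /cvgrPdist_lt/(_ _ e2)[N _ Ne] := flat_cauchy_cvg (FlatCauchy cP).
exists (maxn M N) => // n /=; rewrite geq_max => /andP[Mn Nn].
have Nen : fnorm (flat_of_poly (P n) - flat_lim (FlatCauchy cP)) < e / 2.
  by have := Ne n Nn; rewrite /= sub0r normrN (ger0_norm (fnorm_ge0 _)).
rewrite sub0r normrN (ger0_norm (fnorm_ge0 _)) (splitr e).
apply: le_lt_trans (ler_fnorm_dist _ (flat_of_poly (P n)) _) _; apply: ltrD Nen.
by rewrite fnormBC; exact: lt_trans (PT n) (Me _ Mn).
Qed.

End FlatChains.

Arguments fnorm_lim {R d K G} u.
Arguments flat_cauchy_cvg {R d K G} u.

Section InducedMap.
Context {R : realType} {d : nat}.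
Variable K : set 'rV[R]_d.

Lemma proj_chain0_subproof (P : chain0 K (real_group R)) :
  chain0_pred (G := circle_group R) (fun x : K => circle_proj (P x)).
Proof.
apply/asboolP/(sub_finite_set _ (chain0_finite P)) => x /=.
by apply: contra_neq => ->; rewrite raddf0.
Qed.

Definition proj_chain0 (P : chain0 K (real_group R)) :
  chain0 K (circle_group R) := Chain0 (proj_chain0_subproof P).

Lemma proj_chain0_is_zmod_morphism : zmod_morphism proj_chain0.
Proof.
move=> P Q; apply/val_inj/funext => x.
exact: (raddfB (@circle_proj R) (P x) (Q x)).
Qed.
HB.instance Definition _ := GRing.isZmodMorphism.Build (chain0 K (real_group R))
  (chain0 K (circle_group R)) proj_chain0 proj_chain0_is_zmod_morphism.

Lemma mass0_proj_chain0 P : mass0 (proj_chain0 P) <= mass0 P.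
Proof.
pose A := [set x | P x != 0].
have PA x : ~ A x -> P x = 0 by move=> /negP/negPn/eqP.
rewrite (@mass0E _ _ _ _ _ A) // => [|x /PA Px]; last first.
  by rewrite -[LHS]/(circle_proj (P x)) Px raddf0.
rewrite (@mass0E _ _ _ _ P A) // !fsbig_finite; do ?exact: chain0_finite.
by apply: ler_sum => x _; exact: circle_norm_le.
Qed.

Lemma proj_point_chain x g : proj_chain0 (point_chain x g) =
  point_chain (G := circle_group R) x (circle_proj g).
Proof.
by apply/val_inj/funext => y /=; case: eqP => // _; rewrite raddf0.
Qed.

Lemma flat_norm_proj_chain0 P : flat_norm (proj_chain0 P) <= flat_norm P.
Proof.
apply/ler_addgt0Pr => e e0; have [Q /ltW Qe] := flat_norm_approx P e0.
apply: le_trans Qe.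
pose pQ : seq (circle_group R * simplex1 K) :=
  [seq ((circle_proj q.1 : circle_group R), q.2) | q <- terms1 Q].
apply: le_trans (flat_norm_le _ pQ) _; apply: lerD.
  rewrite /mass1 big_map; apply: ler_sum => q _ /=.
  by rewrite ler_wpM2r ?eucl_dist_ge0 ?circle_norm_le.
have -> : boundary1 pQ = proj_chain0 (boundary1 Q).
  rewrite /boundary1 big_map raddf_sum; apply: eq_bigr => q _ /=.
  by rewrite raddfB /= !proj_point_chain.
by rewrite -raddfB mass0_proj_chain0.
Qed.

Lemma proj_flat_cauchy_subproof (u : flat_cauchy K (real_group R)) :
  flat_cauchy_pred (fun n => proj_chain0 (u n)).
Proof.
case: u => u /= /asboolP cu; apply/asboolP => e /cu[N uN]; exists N => m n Nm Nn.
by rewrite -raddfB (le_lt_trans (flat_norm_proj_chain0 _)) ?uN.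
Qed.

Definition proj_flat_cauchy u := FlatCauchy (proj_flat_cauchy_subproof u).

(* Extension of [proj_chain0] by continuity; see [proj_flat_lim],
   [proj_flat_of_poly] and [fnorm_proj_flat]. *)
Definition proj_flat (T : flat_chain K (real_group R)) :
  flat_chain K (circle_group R) := flat_lim (proj_flat_cauchy (repr T)).

Lemma proj_flat_lim u : proj_flat (flat_lim u) = flat_lim (proj_flat_cauchy u).
Proof.
apply/flat_lim_eq => /=; set v := repr _.
have /flat_lim_eq vu : flat_lim v = flat_lim u by rewrite /flat_lim reprK.
apply: squeeze_cvgr vu; last exact: cvg_cst.
by apply: nearW => n; rewrite flat_norm_ge0 -raddfB flat_norm_proj_chain0.
Qed.

Lemma proj_flat_of_poly P :
  proj_flat (flat_of_poly P) = flat_of_poly (proj_chain0 P).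
Proof. by rewrite proj_flat_lim; congr flat_lim; exact/val_inj. Qed.

Lemma proj_flat_is_zmod_morphism : zmod_morphism proj_flat.
Proof.
move=> S T; have [u <-] := flat_limP S; have [v <-] := flat_limP T.
rewrite -raddfB !proj_flat_lim -raddfB; congr flat_lim.
by apply/val_inj/funext => n; exact: (raddfB proj_chain0).
Qed.
HB.instance Definition _ := GRing.isZmodMorphism.Build _ _
  proj_flat proj_flat_is_zmod_morphism.

Lemma fnorm_proj_flat T : fnorm (proj_flat T) <= fnorm T.
Proof.
have [u <-] := flat_limP T; rewrite proj_flat_lim.
apply: (ler_cvg_to (fnorm_lim _) (fnorm_lim u)).
by apply: nearW => n; exact: flat_norm_proj_chain0.
Qed.

End InducedMap.

(* Main.v *)
(* A flat chain has finite mass iff it is a flat limit of polyhedral chains of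
   uniformly bounded mass, and polyhedral chains with coefficients in R/Z lift to
   real ones of the same mass. On the compact convex set K, real polyhedral
   0-chains of bounded mass are precompact for the flat norm: moving every atom
   to a finite net costs little, and the finitely many resulting coefficients
   are bounded reals. A flat limit point of the lifts is then a preimage of
   finite mass. *)
Require Import Defs.
From HB Require Import structures.
From mathcomp Require Import all_boot all_order all_algebra.
From mathcomp Require Import all_classical all_reals all_analysis.
From mathcomp Require Import ring lra.
Import Order.TTheory GRing.Theory Num.Theory.
Import numFieldNormedType.Exports.
Local Open Scope classical_set_scope.
Local Open Scope ring_scope.

Local Notation gnorm := (@Defs.gnorm _ _).

(** * Finite nets in [K] for the Euclidean distance *)

(** Balls here are those of the sup norm. The factor [d], coarser than its square root, comes from
    [d * e ^ 2 <= (d * e) ^ 2]. *)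
Lemma eucl_dist_le_ball (R : realType) (d : nat) (x y : 'rV[R]_d) (e : R) :
  ball x e y -> eucl_dist x y <= d%:R * e.
Proof.
move=> xye; case: d x y xye => [|d] x y xye.
  by rewrite /eucl_dist big_ord0 sqrtr0 mul0r.
have [e0 xyi] := xye.
rewrite -[leRHS]ger0_norm ?mulr_ge0 ?(ltW e0) // -sqrtr_sqr.
apply: ler_wsqrtr; apply: le_trans (_ : \sum_(i < d.+1) e ^+ 2 <= _).
  apply: ler_sum => i _; rewrite -real_normK ?num_real //.
  by rewrite lerXn2r ?nnegrE ?(ltW e0) //; apply/ltW/xyi.
rewrite sumr_const card_ord exprMn -[leLHS]mulr_natl ler_wpM2r ?sqr_ge0 //.
by rewrite -natrX ler_nat leq_pmulr.
Qed.

Lemma eucl_finite_net (R : realType) (d : nat) (K : set 'rV[R]_d) (e : R) :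
  compact K -> 0 < e ->
  exists (X : seq K) (r : K -> K),
    forall x, r x \in X /\ eucl_dist (val x) (val (r x)) <= e.
Proof.
rewrite compact_cover => cK e0.
(* The divisor absorbs the factor [d] of [eucl_dist_le_ball]; [.+1] keeps it nonzero when
   [d = 0]. *)
have de0 : 0 < e / d.+1%:R by rewrite divr_gt0.
have [|D' _ KD'] := cK K setT (fun x => (ball (val x) (e / d.+1%:R))^°)
  (fun _ _ => open_interior _).
  move=> x Kx; exists (SigSub (mem_set Kx)) => //=; exact: nbhsx_ballx.
have /choice[r rP] (x : K) : exists y, y \in finmap.enum_fset D' /\
    eucl_dist (val x) (val y) <= e.
  have [y yD' /interior_subset yx] := KD' _ (set_valP x).
  exists y; split=> //; rewrite eucl_distC (le_trans (eucl_dist_le_ball _ _ _ _ _ yx)) //.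
  rewrite mulrCA -[leRHS]mulr1 ler_wpM2l ?(ltW e0) //.
  by rewrite ler_pdivrMr ?ltr0n // mul1r ler_nat.
by exists (finmap.enum_fset D'), r.
Qed.

(** * Push-forward of 0-chains onto a net *)

Section Chains.
Context {R : realType} {d : nat}.
Variables (K : set 'rV[R]_d) (G : normedGroup R).
Hypothesis convex_K : convex_set (K : set (convex_lmodType 'rV[R]_d)).

(** The segment from [y] to [x] with coefficient [g] has exactly this boundary and lies in [K] by
    convexity. A simplex has distinct endpoints, hence the separate case [y = x]. *)
Lemma flat_norm_point_chainB (x y : K) (g : G) :
  flat_norm (point_chain x g - point_chain y g) <=
  gnorm g * eucl_dist (val y) (val x).
Proof.
have [->|nyx] := eqVneq y x.
  by rewrite subrr flat_norm0 mulr_ge0 ?gnorm_ge0 ?eucl_dist_ge0.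
have sK : segment (val y) (val x) `<=` K.
  move=> _ [t + <-]; rewrite /= in_itv /= => /andP[t0 t1].
  have /set_mem := @convex_K (val x) (val y) (Itv01 t0 t1)
    (mem_set (set_valP x)) (mem_set (set_valP y)).
  suff <- : t *: val x + (1 - t) *: val y = val y + t *: (val x - val y) by [].
  by apply/rowP => i; rewrite !mxE; ring.
pose s := Simplex1 nyx sK.
apply: le_trans (flat_norm_le _ [:: (g, s)]) _.
by rewrite /mass1 /boundary1 !big_seq1 subrr mass0_0 addr0.
Qed.

Lemma ler_flat_norm_sum (I : Type) (r : seq I) (F : I -> chain0 K G) :
  flat_norm (\sum_(i <- r) F i) <= \sum_(i <- r) flat_norm (F i).
Proof.
elim/big_rec2: _ => [|i x y _ xy]; first by rewrite flat_norm0.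
by rewrite (le_trans (ler_flat_normD _ _)) // lerD2l.
Qed.

Lemma coef0D (P Q : chain0 K G) x : (P + Q) x = P x + Q x.
Proof. by []. Qed.

Lemma coef0B (P Q : chain0 K G) x : (P - Q) x = P x - Q x.
Proof. by []. Qed.

Lemma coef0_sum (I : Type) (r : seq I) (F : I -> chain0 K G) x :
  (\sum_(i <- r) F i) x = \sum_(i <- r) F i x.
Proof. by elim/big_rec2: _ => // i y P _ <-; rewrite coef0D. Qed.

Definition atoms (P : chain0 K G) : seq K :=
  finmap.enum_fset (fset_set [set x | P x != 0]).

Lemma atoms_uniq P : uniq (atoms P).
Proof. exact: finmap.fset_uniq. Qed.

Lemma mem_atoms P x : (x \in atoms P) = (P x != 0).
Proof.
rewrite [LHS]in_fset_set; last exact: chain0_finite.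
by apply/idP/idP; rewrite inE.
Qed.

Lemma chain0_sum_atoms (P : chain0 K G) :
  P = \sum_(x <- atoms P) point_chain x (P x).
Proof.
apply/val_inj/funext => y; rewrite /= coef0_sum /=.
have [/[dup] Py|] := boolP (y \in atoms P).
  move=> yP; rewrite (bigD1_seq y) ?atoms_uniq //= eqxx big1 ?addr0 // => x.
  by rewrite eq_sym => /negPf ->.
rewrite mem_atoms negbK => /eqP Py; rewrite big1_seq ?Py // => x _.
by case: eqP => // <-; rewrite Py.
Qed.

Lemma mass0_atoms (P : chain0 K G) : mass0 P = \sum_(x <- atoms P) gnorm (P x).
Proof.
rewrite (@mass0E _ _ _ _ P [set x | P x != 0]) => [|x /negP/negPn/eqP //].
by rewrite fsbig_finite //; exact: chain0_finite.
Qed.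

Lemma mass0_point_chain (x : K) (g : G) : mass0 (point_chain x g) = gnorm g.
Proof.
rewrite (@mass0E _ _ _ _ _ [set x]) => [|y /= /eqP/negPf -> //].
by rewrite fsbig_set1 /= eqxx.
Qed.

(** This is the coefficient at [y] of the push-forward of [P] under [r]. *)
Definition fiber_sum (r : K -> K) (y : K) (P : chain0 K G) : G :=
  \sum_(x <- atoms P | r x == y) P x.

(** Cancellation makes the atoms of [P - Q] unpredictable; one list containing those of all three
    chains lets [fiber_sumB] be checked term by term. *)
Lemma fiber_sum_widen (r : K -> K) (y : K) (P : chain0 K G) (s : seq K) :
  uniq s -> {subset atoms P <= s} ->
  fiber_sum r y P = \sum_(x <- s | r x == y) P x.
Proof.
move=> us Ps; rewrite /fiber_sum [RHS](bigID (mem (atoms P))) /=.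
rewrite [X in _ = _ + X]big1 ?addr0 => [|x /andP[_]]; last first.
  by rewrite mem_atoms negbK => /eqP.
under [RHS]eq_bigl do rewrite andbC.
rewrite -big_filter_cond; apply: perm_big; apply: uniq_perm.
- exact: atoms_uniq.
- exact: filter_uniq.
- by move=> x; rewrite mem_filter; have [/Ps|] := boolP (x \in atoms P).
Qed.

Lemma fiber_sumB (r : K -> K) (y : K) (P Q : chain0 K G) :
  fiber_sum r y (P - Q) = fiber_sum r y P - fiber_sum r y Q.
Proof.
pose s := undup (atoms P ++ atoms Q).
rewrite !(@fiber_sum_widen r y _ s) ?undup_uniq //.
- by rewrite -sumrB; apply: eq_bigr => x _; rewrite coef0B.
- by move=> x xQ; rewrite mem_undup mem_cat xQ orbT.
- by move=> x xP; rewrite mem_undup mem_cat xP.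
- move=> x; rewrite mem_undup mem_cat !mem_atoms coef0B; apply: contraNT.
  by rewrite negb_or !negbK => /andP[/eqP -> /eqP ->]; rewrite subr0.
Qed.

Lemma ler_gnorm_sum (I : Type) (s : seq I) (C : pred I) (F : I -> G) :
  gnorm (\sum_(i <- s | C i) F i) <= \sum_(i <- s | C i) gnorm (F i).
Proof.
elim/big_rec2: _ => [|i x y _ xy]; first by rewrite gnorm0.
by rewrite (le_trans (ler_gnormD _ _)) // lerD2l.
Qed.

Lemma gnorm_fiber_sum_le r y P : gnorm (fiber_sum r y P) <= mass0 P.
Proof.
rewrite mass0_atoms (le_trans (ler_gnorm_sum _ _ _ _)) //.
rewrite [leRHS](bigID (fun x => r x == y)) /= lerDl sumr_ge0 // => x _.
exact: gnorm_ge0.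
Qed.

(* Each atom is transported along the segment from x to r x, then the atoms
   gathered at each point of the net X are merged. *)
Lemma flat_norm_le_net (e : R) (X : seq K) (r : K -> K) (P : chain0 K G) :
  uniq X -> (forall x, r x \in X) ->
  (forall x, eucl_dist (val (r x)) (val x) <= e) ->
  flat_norm P <= e * mass0 P + \sum_(y <- X) gnorm (fiber_sum r y P).
Proof.
move=> uX rX re.
have PE : P = \sum_(x <- atoms P) (point_chain x (P x) - point_chain (r x) (P x))
    + \sum_(y <- X) point_chain y (fiber_sum r y P).
  rewrite sumrB {1}(chain0_sum_atoms P) -[LHS]addr0 -addrA; congr (_ + _).
  apply/esym/eqP; rewrite addrC subr_eq0; apply/eqP.
  under eq_bigr do rewrite raddf_sum.
  rewrite (exchange_big_dep xpredT) //=; apply: eq_bigr => x _.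
  (* As [X] is duplicate-free and contains [r x], each atom falls into exactly one fiber. *)
  rewrite -big_filter (_ : [seq y <- X | r x == y] = [:: r x]) ?big_seq1 //.
  rewrite (eq_filter (a2 := pred1 (r x))) => [|z]; last by rewrite /= eq_sym.
  exact: filter_pred1_uniq.
rewrite {1}PE (le_trans (ler_flat_normD _ _)) // lerD //.
  rewrite mass0_atoms mulr_sumr (le_trans (ler_flat_norm_sum _ _ _)) //.
  apply: ler_sum => x _; rewrite (le_trans (flat_norm_point_chainB _ _ _)) //.
  by rewrite mulrC ler_wpM2r ?gnorm_ge0.
rewrite (le_trans (ler_flat_norm_sum _ _ _)) //; apply: ler_sum => y _.
by rewrite (le_trans (flat_norm_le_mass0 _)) ?mass0_point_chain.
Qed.

End Chains.

(** * Flat precompactness of real chains of bounded mass *)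

(** Compactness gives a cluster point, and an ultrafilter converges to it: it contains the preimage
    of each neighborhood or of its complement, and the latter would miss the neighborhood. *)
Lemma ultra_bounded_cvg (R : realType) (T : Type) (U : set_system T)
    (f : T -> R) (M : R) :
  UltraFilter U -> (forall t, `|f t| <= M) ->
  exists l : R, f t @[t --> U] --> l.
Proof.
move=> UU fM.
have [|l [_ lU]] := @segment_compact R (- M) M (f @ U) _.
  by apply: (@filterE _ U) => t; rewrite /= in_itv /= -ler_norml; exact: fM.
exists l => B lB; have [//|UB] := in_ultra_setVsetC (f @^-1` B) UU.
have [z [nBz Bz]] := lU (~` B) B UB lB.
by have := nBz Bz.
Qed.

Section Compactness.
Context {R : realType} {d : nat}.
Variable K : set 'rV[R]_d.
Hypothesis convex_K : convex_set (K : set (convex_lmodType 'rV[R]_d)).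
Hypothesis compact_K : compact K.

(* Passing to an ultrafilter replaces the diagonal extraction over ever finer
   nets. *)
Lemma ultra_mass_bounded_cauchy (P : nat -> chain0 K (real_group R)) (M : R)
    (U : set_system nat) :
  UltraFilter U -> (forall n, mass0 (P n) <= M) -> forall e, 0 < e ->
  \forall n \near U, \forall m \near U, flat_norm (P m - P n) < e.
Proof.
move=> UU PM e e0.
have M0 : 0 <= M by rewrite (le_trans (mass0_ge0 (P 0%N))).
(* A difference of two chains has mass at most [2 * M], so transport costs at most
   [dl * (2 * M) < e / 2]. *)
pose dl := e / (4 * (M + 1)).
have dl0 : 0 < dl by rewrite divr_gt0 // mulr_gt0 // ltr_wpDl.
have [X [r rP]] := eucl_finite_net R d K dl compact_K dl0.
(* Two coefficients within [et] of their limit differ by less than [2 * et]; over the net this sums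
   to at most [e / 2], and [.+1] allows an empty net. *)
pose Y := undup X; pose et := e / (4 * (size Y).+1%:R).
have et0 : 0 < et by rewrite divr_gt0 // mulr_gt0.
have /choice[l lP] (y : K) : exists l, fiber_sum K _ r y (P n) @[n --> U] --> (l : R).
  by apply: (@ultra_bounded_cvg R _ U _ M) => n; rewrite (le_trans (gnorm_fiber_sum_le _ _ r y _)).
have near_l : \forall n \near U, forall y, y \in Y ->
    `|l y - fiber_sum K _ r y (P n)| < et.
  elim: (Y) => [|y Z IH]; first exact: (@filterE _ U).
  have /cvgrPdist_lt/(_ et et0) ly := lP y.
  near=> n => z; rewrite inE => /orP[/eqP ->|zZ].
    by near: n.
  by move: z zZ; near: n; exact: IH.
apply: filterS (near_l) => n nP; near=> m.
have [uY YX] : uniq Y /\ (forall x, r x \in Y).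
  by split=> [|x]; rewrite ?undup_uniq // mem_undup; have [] := rP x.
apply: le_lt_trans (@flat_norm_le_net _ _ _ _ convex_K dl Y r _ uY YX _) _.
  by move=> x; rewrite eucl_distC; have [] := rP x.
have m_le : mass0 (P m - P n) <= 2 * M.
  rewrite (le_trans (ler_mass0D _ _)) // mass0N.
  by have := PM m; have := PM n; lra.
have s_le : \sum_(y <- Y) gnorm (fiber_sum K (real_group R) r y (P m - P n)) <=
    (size Y)%:R * (2 * et).
  rewrite mulr_natl -[X in _ *+ X]count_predT -iter_addr_0 -big_const_seq big_seq [leRHS]big_seq.
  apply: ler_sum => y yY; rewrite fiber_sumB.
  have my : `|l y - fiber_sum K _ r y (P m)| < et by move: y yY; near: m.
  have := nP y yY; move: my; rewrite /= !ltr_norml ler_norml.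
  by move=> /andP[? ?] /andP[? ?]; apply/andP; split; lra.
apply: le_lt_trans (lerD (ler_wpM2l (ltW dl0) m_le) s_le) _.
have -> : e = e / 2 + e / 2 by field.
apply: ltr_leD.
  rewrite /dl mulrAC ltr_pdivrMr ?mulr_gt0 ?ltr_wpDl //.
  nra.
have -> : (size Y)%:R * (2 * et) = e / 2 * ((size Y)%:R / (size Y).+1%:R).
  by rewrite /et; field; rewrite nat1r pnatr_eq0.
rewrite ler_piMr ?divr_ge0 ?(ltW e0) //.
by rewrite ler_pdivrMr ?ltr0n // mul1r ler_nat.
Unshelve. all: by end_near. Qed.

(** Each [P (f k)] is close to [P m] for [U]-almost all [m]. Two such sets of indices meet, so two
    chosen chains are compared through a common [P i]. *)
Lemma mass_bounded_cauchy_subseq (P : nat -> chain0 K (real_group R)) (M : R) :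
  (forall n, mass0 (P n) <= M) ->
  exists f : nat -> nat, (forall k, (k <= f k)%N) /\
    flat_cauchy_pred (fun k => P (f k)).
Proof.
move=> PM; have [U [UU ooU]] := ultraFilterLemma (eventually_filter).
have /choice[f fP] (k : nat) : exists n, (k <= n)%N /\
    \forall m \near U, flat_norm (P m - P n) < k.+1%:R^-1.
  apply: (@filter_ex _ U); apply: filterI; first by apply: ooU; exists k.
  exact: (@ultra_mass_bounded_cauchy P M).
exists f; split=> [k|]; first by have [] := fP k.
apply/asboolP => e e0; have e2 : 0 < e / 2 by rewrite divr_gt0.
have [N _ Ne] := near_infty_natSinv_lt (PosNum e2).
exists N => m n Nm Nn.
have [_ Pm] := fP m; have [_ Pn] := fP n.
have [i [/= im in_]] := filter_ex (filterI Pm Pn).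
rewrite -(subrKA (P i)) (splitr e) (le_lt_trans (ler_flat_normD _ _)) //.
rewrite flat_normBC; apply: ltrD.
  exact: lt_trans im (Ne _ Nm).
exact: lt_trans in_ (Ne _ Nn).
Qed.

End Compactness.

(** * Finite mass, lifting and surjectivity *)

(** A real strictly above the lower limit exceeds some mass beyond every rank. Conversely,
    approximations at scale [1 / (n + 1)] form an admissible sequence whose lower limit is at most
    [M]. *)
Lemma mass_lt_pinftyP (R : realType) (d : nat) (K : set 'rV[R]_d)
    (G : normedGroup R) (T : flat_chain K G) :
  (mass T < +oo)%E <->
  exists M : R, forall e : R, 0 < e ->
    exists P, mass0 P <= M /\ fnorm (flat_of_poly P - T) < e.
Proof.
split=> [/ereal_inf_lt[_ [P PT <-]]|[M PM]].
  set u := fun n => (mass0 (P n))%:E => /= uoo.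
  have [M uM] : exists M : R, (limn_einf u < M%:E)%E.
    move: uoo; case: (limn_einf u) => [r _| |_] //; last by exists 0; rewrite ltNyr.
    by exists (r + 1); rewrite lte_fin ltrDl.
  exists M => e e0; have /cvgrPdist_lt/(_ e e0)[N _ PNe] := PT.
  have : (einfs u N < M%:E)%E.
    apply: le_lt_trans uM; rewrite limn_einf_lim.
    rewrite (cvg_lim _ (@cvg_einfs_sup _ u)) //.
    by apply: ereal_sup_ubound; exists N.
  move=> /ereal_inf_lt[_ [k /= Nk <-]]; rewrite lte_fin => Pk.
  exists (P k); split; first exact: ltW.
  by have := PNe k Nk; rewrite /= sub0r normrN ger0_norm ?fnorm_ge0.
have /choice[P PP] (n : nat) :
    exists P, mass0 P <= M /\ fnorm (flat_of_poly P - T) < n.+1%:R^-1.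
  exact: PM.
apply: (@le_lt_trans _ _ M%:E); last exact: ltry.
apply: (@le_trans _ _ (limn_einf (fun n => (mass0 (P n))%:E))).
  apply: ereal_inf_lbound; exists P => //=.
  apply/cvgrPdist_lt => e e0; have [N _ Ne] := near_infty_natSinv_lt (PosNum e0).
  exists N => // n Nn; rewrite /= sub0r normrN ger0_norm ?fnorm_ge0 //.
  exact: lt_trans (PP n).2 (Ne n Nn).
rewrite limn_einf_lim.
apply: lime_le; first exact: is_cvg_einfs.
apply: nearW => n; apply: (@le_trans _ _ (mass0 (P n))%:E).
  by apply: ereal_inf_lbound; exists n => /=.
by rewrite lee_fin; have [] := PP n.
Qed.

(** Each coefficient is lifted to a representative of least absolute value; 0 lifts to 0, so the
    support stays finite. *)
Lemma proj_chain0_lift (R : realType) (d : nat) (K : set 'rV[R]_d)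
    (Q : chain0 K (circle_group R)) :
  exists P, proj_chain0 P = Q /\ mass0 P = mass0 Q.
Proof.
have /choice[c cP] (t : circle R) :
    exists x, circle_proj x = t /\ `|x| = circle_norm t.
  by have [x] := circle_norm_repr t; exists x.
have Pfin : chain0_pred (G := real_group R) (fun x : K => c (Q x)).
  apply/asboolP/(sub_finite_set _ (chain0_finite Q)) => x /=.
  by apply: contra_neq => Qx; apply/eqP; rewrite -normr_eq0 (cP _).2 circle_norm_eq0 Qx.
exists (Chain0 Pfin); split; first by apply/val_inj/funext => x; exact: (cP _).1.
by apply: eq_fsbigr => x _; exact: (cP _).2.
Qed.

Theorem theorem5p6 (R : realType) (d : nat) (K : set 'rV[R]_d)
  (convex_K : convex_set (K : set (convex_lmodType 'rV[R]_d)))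
  (compact_K : compact K)
  (interior_K : K° !=set0) :
  let finR := [set T : flat_chain K (real_group R) | (mass T < +oo)%E] in
  let finS1 := [set T : flat_chain K (circle_group R) | (mass T < +oo)%E] in
  set_fun finR finS1 (@proj_flat R d K) /\ set_surj finR finS1 (@proj_flat R d K).
Proof.
move=> finR finS1; split=> [T /mass_lt_pinftyP[M TM]|T /mass_lt_pinftyP[M TM]].
  (* Projection increases neither the mass nor the flat norm. *)
  apply/mass_lt_pinftyP; exists M => e /TM[P [PM PT]].
  exists (proj_chain0 P); split; first exact: le_trans (mass0_proj_chain0 P) PM.
  by rewrite -proj_flat_of_poly -raddfB (le_lt_trans (fnorm_proj_flat _)).
have /choice[P PP] (n : nat) : exists P, mass0 P <= M /\
    fnorm (flat_of_poly (proj_chain0 P) - T) < n.+1%:R^-1.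
  have [|Q [QM QT]] := TM n.+1%:R^-1; first by rewrite invr_gt0.
  have [P [PQ PE]] := proj_chain0_lift _ _ _ Q.
  by exists P; rewrite PQ PE.
have [f [fk cPf]] := mass_bounded_cauchy_subseq _ convex_K compact_K P M
  (fun n => (PP n).1).
pose u := FlatCauchy cPf; have /cvgrPdist_lt uT := flat_cauchy_cvg u.
have dist_lt (e : R) : 0 < e -> exists n, [/\
    fnorm (flat_of_poly (u n) - flat_lim u) < e & n.+1%:R^-1 < e].
  move=> e0; have [N _ uN] := uT e e0.
  have [N' _ N'e] := near_infty_natSinv_lt (PosNum e0).
  exists (maxn N N'); split; last by apply: N'e; rewrite /= leq_maxr.
  have := uN (maxn N N') (leq_maxl _ _).
  by rewrite /= sub0r normrN ger0_norm ?fnorm_ge0.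
exists (flat_lim u).
  apply/mass_lt_pinftyP; exists M => e /dist_lt[n [un _]].
  by exists (u n); split=> //; exact: (PP _).1.
(* Both [proj_flat (flat_lim u)] and [T] lie within [e / 2] of the projection of [u n]. *)
apply/eqP; rewrite -subr_eq0 -fnorm_eq0 eq_le fnorm_ge0 andbT.
apply/ler_addgt0Pr => e e0; have [|n [un ne]] := dist_lt (e / 2).
  by rewrite divr_gt0.
rewrite add0r (splitr e) (le_trans (ler_fnorm_dist _ (proj_flat (flat_of_poly (u n))) _)) //.
apply: lerD.
  rewrite -(raddfB (@proj_flat R d K)); apply: le_trans (fnorm_proj_flat _) _.
  by rewrite fnormBC; exact: ltW.
(* Here [n <= f n] turns the rate [1 / (f n + 1)] into [1 / (n + 1)]. *)
rewrite proj_flat_of_poly (le_trans (ltW (PP (f n)).2)) // (le_trans _ (ltW ne)) //.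
by rewrite lef_pV2 ?posrE // ler_nat ltnS.
Qed.
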